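(* Assume that the event $\bigcup_{j=0}^N\{V_{t_j+}=P_{t_j}\}$ has probability zero. Then for any $t\in[0,T]$, as $\lambda\downarrow0$, the stopping time $\hat\tau^\lambda_t$ converges almost surely to the stopping time $\tau^*_t$.
   Context: Setting. $(\Omega,\mathcal F,\mathbb P,\mathbb F)$ is a filtered probability space whose filtration $\mathbb F=(\mathcal F_t)_{t\ge0}$ satisfies the usual conditions; martingales are càdlàg. $T>0$, $S=\{t_0,t_1,\dots,t_N\}$ with $0=t_0<t_1<\dots<t_N<T$, and $t_{N+1}:=T$. $P$ is a non-negative $\mathbb F$-adapted process with $\max_{u\in S\cup\{T\}}\mathbb E[P_u]<\infty$. $\mathcal T_{t,T}(S)$ is the set of $\mathbb F$-stopping times with values in $(S\cup\{T\})\cap[t,T]$. $X_{t+}$ denotes the right limit of a process $X$ at $t$. Value process. $V_t=\operatorname{ess\,sup}_{\tau\in\mathcal T_{t,T}(S)}\mathbb E[P_\tau|\mathcal F_t]$; it satisfies $V_t=P_T-(M_T-M_t)+\sum_{t\le t_i<T}(P_{t_i}-V_{t_i+})^+$ with $M$ a uniformly integrable martingale. Entropy-regularised value. For $x\ne0$, $\Psi(x)=\frac1x\ln\big(\frac{e^x-1}{x}\big)$, $\Psi(0)=\frac12$, $\Phi(x)=x\Psi(x)$. For $\lambda>0$, $(V^\lambda,M^\lambda)$ is the unique pair ($V^\lambda$ of class (D), $M^\lambda$ a uniformly integrable martingale with $M^\lambda_0=0$) solving $V^\lambda_t=P_T-(M^\lambda_T-M^\lambda_t)+\sum_{t\le t_i<T}\lambda\Phi(\lambda^{-1}(P_{t_i}-V^\lambda_{t_i+}))$,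 $t\in[0,T]$. Equivalently: $V^\lambda_T=P_T$, $V^\lambda_t=\mathbb E[V^\lambda_{t_{j+1}}|\mathcal F_t]$ for $t\in(t_j,t_{j+1}]$, $V^\lambda_{t_j+}=\mathbb E[V^\lambda_{t_{j+1}}|\mathcal F_{t_j}]$ and $V^\lambda_{t_j}=V^\lambda_{t_j+}+\lambda\Phi(\lambda^{-1}(P_{t_j}-V^\lambda_{t_j+}))$. Stopping times. For $t\in[0,T]$, $$\tau^*_t=\inf\{s\in S\cup\{T\}:\ s\ge t,\ V_s=P_s\},\qquad \hat\tau^\lambda_t=\inf\{s\in S\cup\{T\}:\ s\ge t,\ V^\lambda_{s+}\le P_s\},$$ with the convention $V^\lambda_{T+}:=P_T$ (so that $T$ always belongs to both sets). *)

(* Defs.v *)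
From HB Require Import structures.
From mathcomp Require Import all_boot all_order all_algebra.
From mathcomp Require Import all_classical all_reals all_analysis.

Set Implicit Arguments.
Unset Strict Implicit.
Unset Printing Implicit Defensive.

Import Order.TTheory GRing.Theory Num.Theory.
Import numFieldNormedType.Exports.

Local Open Scope classical_set_scope.
Local Open Scope ring_scope.

(* A real process is a function [X : R -> Omega -> R] (time first); only its
   values on [[0, T]] matter.  A filtration is a function
   [F : R -> set_system Omega] of which only the values at [t >= 0] matter. *)

Section Probability.
Context d (Omega : measurableType d) (R : realType) (Pr : probability Omega R).
Implicit Types (F : R -> set_system Omega) (G : set_system Omega).
Implicit Types (X Y : Omega -> R) (tau : Omega -> R).

Definition usual_filtration F : Prop :=
  [/\ forall t, 0 <= t -> sigma_algebra setT (F t) /\ F t `<=` measurable,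
      forall s t, 0 <= s -> s <= t -> F s `<=` F t,
      forall t, 0 <= t -> F t = \bigcap_(s in [set s | t < s]) F s
    & Pr.-negligible `<=` F 0].

Definition measurable_wrt G X : Prop :=
  forall B : set R, measurable B -> G (X @^-1` B).

(* [Y] is a version of the conditional expectation of [X] given [G] *)
Definition is_condexp G X Y : Prop :=
  [/\ Pr.-integrable setT (EFin \o X),
      Pr.-integrable setT (EFin \o Y),
      measurable_wrt G Y
    & forall A, G A ->
        (\int[Pr]_(w in A) (Y w)%:E = \int[Pr]_(w in A) (X w)%:E)%E].

(* essential supremum of a family of random variables; not to be confused
   with the library's [ess_sup], which is the (deterministic) essential
   supremum of one function *)
Definition is_esssup (A : set (Omega -> R)) Y : Prop :=
  [/\ measurable_fun setT Y,
      forall X, A X -> {ae Pr, forall w, X w <= Y w}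
    & forall Z : Omega -> R, measurable_fun setT Z ->
        (forall X, A X -> {ae Pr, forall w, X w <= Z w}) ->
        {ae Pr, forall w, Y w <= Z w}].

Definition uniformly_integrable (A : set (Omega -> R)) : Prop :=
  (forall X, A X -> measurable_fun setT X) /\
  forall e : R, 0 < e -> exists K : R, forall X, A X ->
    (\int[Pr]_(w in [set w | (K <= `|X w|)%R]) (`|X w|%:E) <= e%:E)%E.

Definition stopping_time F tau : Prop :=
  forall s, 0 <= s -> F s [set w | tau w <= s].

Definition stopped (X : R -> Omega -> R) tau : Omega -> R :=
  fun w => X (tau w) w.

(* [X_{t+}]; as [lim] is total, this is meaningful on the paths of [X] which
   do have a right limit at [t] *)
Definition right_limit (X : R -> Omega -> R) (t : R) : Omega -> R :=
  fun w => lim (X s w @[s --> t^'+]).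

Definition cadlag_on (T : R) (f : R -> R) : Prop :=
  (forall s, 0 <= s < T -> f x @[x --> s^'+] --> f s) /\
  (forall s, 0 < s <= T -> cvg (f x @[x --> s^'-])).

Definition adapted (T : R) F (X : R -> Omega -> R) : Prop :=
  forall t, 0 <= t <= T -> measurable_wrt (F t) (X t).

Definition class_D (T : R) F (X : R -> Omega -> R) : Prop :=
  uniformly_integrable
    [set Z | exists tau, [/\ stopping_time F tau,
                             forall w, 0 <= tau w <= T & Z = stopped X tau]].

Definition ui_martingale (T : R) F (M : R -> Omega -> R) : Prop :=
  [/\ adapted T F M,
      forall s t, 0 <= s -> s <= t -> t <= T -> is_condexp (F s) (M t) (M s),
      {ae Pr, forall w, cadlag_on T (M ^~ w)}
    & uniformly_integrable [set M t | t in [set t | 0 <= t <= T]]].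

End Probability.

Section OptimalStopping.
Context d (Omega : measurableType d) (R : realType) (Pr : probability Omega R).
Context (F : R -> set_system Omega) (T : R) (N : nat) (tt : 'I_N.+1 -> R).
Context (P : R -> Omega -> R).
Implicit Types (V M : R -> Omega -> R) (t : R) (tau : Omega -> R).

Definition exercise_grid : Prop :=
  [/\ tt ord0 = 0,
      forall i j : 'I_N.+1, (i < j)%N -> tt i < tt j
    & tt ord_max < T].

(* [S `|` {T}] where [S = {t_0, ..., t_N}] *)
Definition exercise_dates : set R := range tt `|` [set T].

Definition exercise_rules t : set (Omega -> R) :=
  [set tau | stopping_time F tau /\
             forall w, exercise_dates (tau w) /\ t <= tau w <= T].

(* The last clause selects the version of the value process whose right
   limits [V_{t_i+}] are considered. *)
Definition value_process V : Prop :=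
  [/\ adapted T F V,
      forall t, 0 <= t <= T ->
        is_esssup Pr [set Y | exists2 tau, exercise_rules t tau &
                                is_condexp Pr (F t) (stopped P tau) Y] (V t)
    & exists2 M, ui_martingale Pr T F M &
        {ae Pr, forall w, forall t, 0 <= t <= T ->
          V t w = P T w - (M T w - M t w)
            + \sum_(i < N.+1 | t <= tt i < T)
                Num.max (P (tt i) w - right_limit V (tt i) w) 0}].

Definition Psi (x : R) : R :=
  if x == 0 then 2^-1 else x^-1 * ln ((expR x - 1) / x).

Definition Phi (x : R) : R := x * Psi x.

Definition entropy_solution (lambda : R) V M : Prop :=
  [/\ adapted T F V, class_D Pr T F V, ui_martingale Pr T F M,
      {ae Pr, forall w, M 0 w = 0}
    & {ae Pr, forall w, forall t, 0 <= t <= T ->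
        V t w = P T w - (M T w - M t w)
          + \sum_(i < N.+1 | t <= tt i < T)
              lambda * Phi (lambda^-1 * (P (tt i) w
                                         - right_limit V (tt i) w))}].

Definition tau_star V t : Omega -> R := fun w =>
  inf [set s | [/\ exercise_dates s, t <= s & V s w = P s w]].

(* [X_{s+}] with the convention [X_{T+} := P_T] *)
Definition right_limit_conv V (s : R) : Omega -> R := fun w =>
  if s == T then P T w else right_limit V s w.

Definition tau_hat V t : Omega -> R := fun w =>
  inf [set s | [/\ exercise_dates s, t <= s & right_limit_conv V s w <= P s w]].

(* On [[0, T]], up to one null set *)
Definition indistinguishable V V' : Prop :=
  {ae Pr, forall w, forall t, 0 <= t <= T -> V t w = V' t w}.

End OptimalStopping.

(* Main.v *)
Require Import Defs.
From HB Require Import structures.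
From mathcomp Require Import all_boot all_order all_algebra.
From mathcomp Require Import all_classical all_reals all_analysis.
From mathcomp Require Import measurable_realfun ring lra.

Set Implicit Arguments.
Unset Strict Implicit.
Unset Printing Implicit Defensive.

Import Order.TTheory GRing.Theory Num.Theory.
Import numFieldNormedType.Exports.

Local Open Scope classical_set_scope.
Local Open Scope ring_scope.

(** Both value processes solve the same backward equation
      X_t = P_T - (M_T - M_t) + sum over t <= t_i < T of phi (P_i - X_(t_i+)),
    with phi (x) = x^+ for V and phi (x) = lambda Phi (x / lambda) for V^lambda.
    The functions phi are nondecreasing and 1-Lipschitz, and the two differ by
    at most sqrt lambda (1 + |x|) ([entropic_part_approx]).

    Path by path, the equation says that on (t_j, t_(j+1)] the process X moves
    like the martingale M, and that X_(t_j) = y + phi (P_j - y) for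
    y = X_(t_j+) ([backward_process_relations]).  A backward induction over the
    dates then compares V with V^lambda at a rate that depends on V only:
    almost surely
      |V_(t_k) - V^lambda_(t_k)| <= sqrt lambda (N + 1 - k) (1 + V_(t_k)).
    - From t_(j+1) to t_j+, such a bound is preserved because it is linear in
      the two processes and nonnegative, so that it passes to conditional
      expectations; these are taken at dates s > t_j, where the processes are
      adapted, and then s decreases to t_j ([close_right_limit]).
    - From t_j+ to t_j, the map y -> y + phi (P_j - y) is nonexpansive, and
      replacing one phi by the other costs sqrt lambda (1 + |P_j - V_(t_j+)|),
      where |P_j - V_(t_j+)| <= max (P_j, V_(t_j+)) = V_(t_j) because
      both are nonnegative ([close_date]).

    Hence V^lambda_(t_j+) -> V_(t_j+) almost surely, with an exceptional set
    that is null for each lambda: a countable union for a sequence, and for the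
    whole family one takes for W lambda the path of V^lambda where the bound
    holds and the path of V elsewhere.  Finally V_(t_j) = P_j is equivalent to
    V_(t_j+) <= P_j, where equality is excluded almost surely; so for small
    lambda it is equivalent to V^lambda_(t_j+) <= P_j at all of the finitely
    many dates, and the two hitting times are eventually equal
    ([tau_hat_cvg_tau_star]). *)

(** * The entropic driver *)

Lemma Phi0 (R : realType) : Phi (0 : R) = 0.
Proof. by rewrite /Phi mul0r. Qed.

Lemma Phi_neq0 (R : realType) (x : R) : x != 0 ->
  Phi x = ln ((expR x - 1) / x).
Proof.
by move=> x0; rewrite /Phi /Psi (negbTE x0) mulrA divff// mul1r.
Qed.

Lemma expR_slope_gt0 (R : realType) (x : R) : x != 0 -> 0 < (expR x - 1) / x.
Proof.
rewrite neq_lt => /orP[x0|x0].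
  by rewrite nmulr_lgt0 ?invr_lt0// subr_lt0 expR_lt1.
by rewrite divr_gt0// subr_gt0 expR_gt1.
Qed.

(** This symmetry turns every statement about [Phi] on the positive half-line
    into one on the negative half-line, and monotonicity into 1-Lipschitz
    continuity. *)
Lemma PhiN (R : realType) (x : R) : Phi (- x) = Phi x - x.
Proof.
have [->|x0] := eqVneq x 0; first by rewrite oppr0 addr0.
have Nx0 : - x != 0 by rewrite oppr_eq0.
rewrite !Phi_neq0//.
have -> : (expR (- x) - 1) / - x = (expR x - 1) / x * expR (- x).
  rewrite mulrAC [X in X / x]mulrBl mul1r expRxMexpNx_1.
  by rewrite invrN mulrN -mulNr opprB.
by rewrite lnM ?posrE ?expR_gt0 ?expR_slope_gt0// expRK.
Qed.

(** Convexity of the exponential, in the form that gives the monotonicity of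
    its chord slopes by combining the tangent inequality at two points. *)
Lemma expR_ge_tangent (R : realType) (x y : R) :
  expR x * (1 + y - x) <= expR y.
Proof.
rewrite -[in leRHS](subrK x y) expRD mulrC ler_wpM2r ?expR_ge0//.
by rewrite -addrA expR_ge1Dx.
Qed.

(** [Phi] is the logarithm of the slope of the chord of [expR] between [0] and
    [x], and the chord slopes of a convex function increase. *)
Lemma Phi_homo (R : realType) : {homo @Phi R : x y / x <= y}.
Proof.
have pos (x y : R) : 0 < x -> x <= y -> Phi x <= Phi y.
  move=> x0 xy; have y0 : 0 < y by exact: lt_le_trans xy.
  rewrite !Phi_neq0 ?gt_eqF// ler_ln ?posrE ?expR_slope_gt0 ?gt_eqF//.
  rewrite ler_pdivrMr// mulrAC ler_pdivlMr//.
  have := expR_ge_tangent x y; have := expR_ge_tangent x 0; rewrite expR0.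
  by nra.
have neg (x y : R) : y < 0 -> x <= y -> Phi x <= Phi y.
  move=> y0 xy; have x0 : x < 0 by exact: le_lt_trans y0.
  rewrite !Phi_neq0 ?lt_eqF// ler_ln ?posrE ?expR_slope_gt0 ?lt_eqF//.
  rewrite ler_ndivrMr// mulrAC ler_ndivrMr//.
  have := expR_ge_tangent y x; have := expR_ge_tangent y 0; rewrite expR0.
  by nra.
have ge0 (x : R) : 0 <= x -> 0 <= Phi x.
  rewrite le_eqVlt => /predU1P[<-|x0]; first by rewrite Phi0.
  rewrite Phi_neq0 ?gt_eqF// ln_ge0// ler_pdivlMr// mul1r.
  by rewrite lerBrDl expR_ge1Dx.
have le0 (x : R) : x <= 0 -> Phi x <= 0.
  rewrite le_eqVlt => /predU1P[->|x0]; first by rewrite Phi0.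
  rewrite Phi_neq0 ?lt_eqF// ln_le0// ler_ndivrMr// mul1r.
  by rewrite lerBrDl expR_ge1Dx.
move=> x y xy; have [x0|x0] := ltP 0 x; first exact: pos.
have [y0|y0] := ltP y 0; first exact: neg.
exact: le_trans (le0 _ x0) (ge0 _ y0).
Qed.

(** With [x = 0] read as a limit, this is [x / (1 - expR (- x)) <= 1 + x]: the
    gap between [Phi] and the positive part is only logarithmic. *)
Lemma le_PhiN (R : realType) (x : R) : 0 <= x -> - Phi (- x) <= ln (1 + x).
Proof.
rewrite le_eqVlt => /predU1P[<-|x0].
  by rewrite oppr0 Phi0 oppr0 addr0 ln1.
have Nx0 : - x != 0 by rewrite oppr_eq0 gt_eqF.
rewrite Phi_neq0// -lnV ?posrE ?expR_slope_gt0// ler_ln ?posrE; last 2 first.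
- by rewrite invr_gt0 expR_slope_gt0.
- by rewrite addr_gt0.
have e1 : expR (- x) < 1 by rewrite expR_lt1 oppr_lt0.
rewrite invf_div ler_ndivrMr ?subr_lt0//.
have := expR_ge_tangent (- x) 0; rewrite expR0; nra.
Qed.

(** This is [lambda * ln (int_0^1 exp (u * x / lambda) du)], a softened positive
    part of [x]. *)
Definition entropic_part (R : realType) (lambda x : R) : R :=
  lambda * Phi (lambda^-1 * x).

Definition slopes_in01 (R : realType) (phi : R -> R) : Prop :=
  forall x y, x <= y -> 0 <= phi y - phi x <= y - x.

Lemma slopes_in01_pos_part (R : realType) :
  slopes_in01 (fun x : R => Num.max x 0).
Proof.
by move=> x y xy; case: (leP x 0) => x0; case: (leP y 0) => y0; lra.
Qed.

Lemma slopes_in01_entropic_part (R : realType) (lambda : R) :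
  0 < lambda -> slopes_in01 (entropic_part lambda).
Proof.
move=> l0 x y xy.
have xy' : lambda^-1 * x <= lambda^-1 * y by rewrite ler_pM2l ?invr_gt0.
have xyN : - (lambda^-1 * y) <= - (lambda^-1 * x) by rewrite lerN2.
apply/andP; split; first by rewrite subr_ge0 ler_pM2l// Phi_homo.
have := Phi_homo xyN; rewrite !PhiN => h.
have := ler_wpM2l (ltW l0) h; rewrite !mulrBr !mulVKf ?gt_eqF//.
by rewrite /entropic_part; lra.
Qed.

Lemma slopes_in01_le_norm (R : realType) (phi : R -> R) x :
  slopes_in01 phi -> phi 0 = 0 -> `|phi x| <= `|x|.
Proof.
move=> hphi phi0; have [x0|x0] := leP 0 x.
  by have := hphi _ _ x0; rewrite phi0 (ger0_norm x0) ler_norml; lra.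
by have := hphi _ _ (ltW x0); rewrite phi0 (ltr0_norm x0) ler_norml; lra.
Qed.

(** One step of the backward recursion does not spread errors: the slopes of
    [x |-> x + phi (p - x)] are [1] minus those of [phi]. *)
Lemma slopes_in01_update (R : realType) (phi : R -> R) (p x y : R) :
  slopes_in01 phi -> `|(x + phi (p - x)) - (y + phi (p - y))| <= `|x - y|.
Proof.
move=> hphi; wlog xy : x y / x <= y => [hw|].
  have [|/ltW] := leP x y; first exact: hw.
  by move/hw; rewrite distrC [leRHS]distrC.
have := hphi (p - y) (p - x); rewrite lerD2l lerN2 => /(_ xy) h.
rewrite [leRHS]distrC [leRHS]ger0_norm ?subr_ge0// ler_norml; lra.
Qed.

(** The error is [lambda * ln (1 + `|x| / lambda)] at most.  It is bounded by an
    affine function of [`|x|], which conditional expectations can propagate,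
    at the price of the rate [sqrt lambda]. *)
Lemma entropic_part_approx (R : realType) (lambda x : R) : 0 < lambda ->
  `|Num.max x 0 - entropic_part lambda x| <= Num.sqrt lambda * (1 + `|x|).
Proof.
move=> l0; set m := Num.sqrt lambda.
have m0 : 0 < m by rewrite sqrtr_gt0.
have lE : lambda = m ^+ 2 by rewrite sqr_sqrtr// ltW.
have bound (y : R) : 0 <= y ->
    0 <= - (lambda * Phi (- (lambda^-1 * y))) <= m * (1 + y).
  move=> y0; have z0 : 0 <= lambda^-1 * y by rewrite mulr_ge0// invr_ge0 ltW.
  rewrite -mulrN; apply/andP; split.
    by rewrite mulr_ge0// ?(ltW l0)// oppr_ge0 -(@Phi0 R) Phi_homo// oppr_le0.
  have -> : m * (1 + y) = lambda * ((1 + y) / m).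
    by rewrite lE; field; rewrite gt_eqF.
  rewrite ler_pM2l//; apply: le_trans (le_PhiN z0) _.
  have a0 : 0 <= (1 + y) / m / 2 by rewrite !divr_ge0 ?addr_ge0// ltW.
  (* [1 + y / m^2 <= (1 + (1 + y) / (2 m))^2] because [4 y <= (1 + y)^2] *)
  have h : 1 + lambda^-1 * y <= (1 + (1 + y) / m / 2) ^+ 2.
    have h1 : lambda^-1 * y <= ((1 + y) / m / 2) ^+ 2.
      rewrite lE !expr_div_n mulrC mulrAC ler_pM2r ?invr_gt0 ?exprn_gt0//.
      by rewrite ler_pdivlMr//; have := sqr_ge0 (1 - y); lra.
    by rewrite sqrrD expr1n mul1r; lra.
  apply: (@le_trans _ _ (ln ((1 + (1 + y) / m / 2) ^+ 2))).
    by rewrite ler_ln ?posrE// ?exprn_gt0//; lra.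
  rewrite lnXn; last lra.
  rewrite [leRHS](_ : _ = ((1 + y) / m / 2) *+ 2); last first.
    by rewrite -mulr_natr; field; rewrite gt_eqF.
  by rewrite lerMn2r /= le_ln1Dx//; lra.
have [x0|x0] := leP 0 x.
  have := bound _ x0; rewrite PhiN mulrBr mulVKf ?gt_eqF//.
  rewrite /entropic_part (ger0_norm x0) => h.
  by rewrite ler_norml; lra.
have Nx0 : 0 <= - x by rewrite oppr_ge0 ltW.
have := bound _ Nx0; rewrite mulrN opprK.
rewrite /entropic_part (ltr0_norm x0) => h.
by rewrite ler_norml; lra.
Qed.

(** * Exercise dates *)

(** The dates [t_0 < ... < t_N < t_(N+1) = T] indexed by [nat]. *)
Definition date (R : realType) (T : R) (N : nat) (tt : 'I_N.+1 -> R)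
  (k : nat) : R := if (k <= N)%N then tt (inord k) else T.

Lemma date_ord (R : realType) (T : R) (N : nat) (tt : 'I_N.+1 -> R)
  (j : 'I_N.+1) : date T tt j = tt j.
Proof. by rewrite /date -ltnS ltn_ord inord_val. Qed.

Lemma date_last (R : realType) (T : R) (N : nat) (tt : 'I_N.+1 -> R) :
  date T tt N.+1 = T.
Proof. by rewrite /date ltnn. Qed.

Lemma grid_lt_T (R : realType) (T : R) (N : nat) (tt : 'I_N.+1 -> R)
  (j : 'I_N.+1) : exercise_grid T tt -> tt j < T.
Proof.
case=> _ incr; apply: le_lt_trans.
have [->|jN] := eqVneq j ord_max; first by [].
apply/ltW/incr; rewrite ltn_neqAle -ltnS ltn_ord andbT.
by apply: contraNneq jN => jN; apply/eqP/val_inj.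
Qed.

Lemma grid_ge0 (R : realType) (T : R) (N : nat) (tt : 'I_N.+1 -> R)
  (j : 'I_N.+1) : exercise_grid T tt -> 0 <= tt j.
Proof.
case=> t0 incr _; rewrite -t0.
have [->|j0] := eqVneq j ord0; first by [].
by apply/ltW/incr; rewrite lt0n.
Qed.

Lemma ltr_date (R : realType) (T : R) (N : nat) (tt : 'I_N.+1 -> R)
  (k l : nat) :
  exercise_grid T tt -> (k < l <= N.+1)%N -> date T tt k < date T tt l.
Proof.
move=> grid /andP[kl]; rewrite leq_eqVlt => /predU1P[lN|lN].
  have kN : (k < N.+1)%N by rewrite -lN.
  by rewrite lN date_last (date_ord T tt (Ordinal kN)); exact: grid_lt_T.
have kN : (k < N.+1)%N := ltn_trans kl lN.
rewrite (date_ord T tt (Ordinal kN)) (date_ord T tt (Ordinal lN)).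
by case: grid => _ incr _; exact: incr.
Qed.

Lemma ler_date (R : realType) (T : R) (N : nat) (tt : 'I_N.+1 -> R)
  (k l : nat) :
  exercise_grid T tt -> (k <= l <= N.+1)%N -> date T tt k <= date T tt l.
Proof.
move=> grid /andP[]; rewrite leq_eqVlt => /predU1P[->//|kl lN].
by apply/ltW/ltr_date => //; rewrite kl.
Qed.

Lemma date_itv (R : realType) (T : R) (N : nat) (tt : 'I_N.+1 -> R) (k : nat) :
  exercise_grid T tt -> (k <= N.+1)%N -> 0 <= date T tt k <= T.
Proof.
move=> grid kN; apply/andP; split; last first.
  by rewrite -[leRHS](date_last T tt); apply: ler_date; rewrite ?kN ?leqnn.
apply: (@le_trans _ _ (date T tt 0)); last by rewrite ler_date.
by rewrite (date_ord T tt ord0); exact: grid_ge0 grid.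
Qed.

Lemma grid_after (R : realType) (T : R) (N : nat) (tt : 'I_N.+1 -> R)
    (k : nat) (s : R) (i : 'I_N.+1) : exercise_grid T tt -> (k <= N)%N ->
  date T tt k < s <= date T tt k.+1 -> (s <= tt i < T) = (k < i)%N.
Proof.
move=> grid kN /andP[ks sk]; rewrite grid_lt_T// andbT.
have [ki|ik] := ltnP k i.
  apply: le_trans sk _; rewrite -(date_ord T tt); apply: ler_date => //.
  by rewrite ki ltnW.
apply/negbTE; rewrite -ltNge; apply: le_lt_trans ks.
by rewrite -(date_ord T tt); apply: ler_date => //; rewrite ik leqW.
Qed.

Lemma grid_from (R : realType) (T : R) (N : nat) (tt : 'I_N.+1 -> R)
    (i j : 'I_N.+1) : exercise_grid T tt -> (tt j <= tt i < T) = (j <= i)%N.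
Proof.
move=> grid; rewrite grid_lt_T// andbT.
case: grid => _ incr _; have [ij|] := ltnP i j.
  by apply/negbTE; rewrite -ltNge incr.
rewrite leq_eqVlt => /predU1P[/val_inj ->|/incr/ltW //]; exact: lexx.
Qed.

(** * Paths of the backward equation *)

Section BackwardPath.
Context (R : realType) (T : R) (N : nat) (tt : 'I_N.+1 -> R).
Context (grid : exercise_grid T tt).
Context (phi : R -> R) (v m : R -> R) (p : R -> R).
Let r j := lim (v s @[s --> (tt j)^'+]).
Context (m_cadlag : cadlag_on T m).
Context (v_eq : forall t, 0 <= t <= T ->
  v t = p T - (m T - m t)
    + \sum_(i < N.+1 | t <= tt i < T) phi (p (tt i) - r i)).

Lemma backward_path_T : v T = p T.
Proof.
rewrite v_eq ?lexx ?andbT; last first.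
  by have /andP[] := date_itv grid (leqnn _); rewrite date_last.
by rewrite big_pred0 ?addr0 ?subrr ?subr0// => i; rewrite leNgt andNb.
Qed.

(** No exercise date lies in [[s, t_(j+1))], so the same terms occur in the sums
    at both ends. *)
Lemma backward_path_increment (j : 'I_N.+1) s : tt j < s <= date T tt j.+1 ->
  v s = v (date T tt j.+1) - (m (date T tt j.+1) - m s).
Proof.
move=> js; have jN : (j <= N)%N by rewrite -ltnS.
have js' : date T tt j < s <= date T tt j.+1 by rewrite date_ord.
have jj : date T tt j < date T tt j.+1 <= date T tt j.+1.
  by rewrite lexx andbT ltr_date// ltnSn.
have j0 : 0 <= tt j by exact: grid_ge0 grid.
have [_ jT] := andP (date_itv grid (ltn_ord j)).
rewrite !v_eq; [|lra..].
under eq_bigl do rewrite (grid_after _ _ _ js')//.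
under [in RHS]eq_bigl do rewrite (grid_after _ _ _ jj)//.
by rewrite opprB; ring.
Qed.

(** The existence of the right limit comes from the right-continuity of the
    martingale, as [v - m] is constant on the interval after [t_j]. *)
Lemma backward_path_right_limit (j : 'I_N.+1) :
  v s @[s --> (tt j)^'+] --> r j /\
  r j = v (date T tt j.+1) - (m (date T tt j.+1) - m (tt j)).
Proof.
suff h : v s @[s --> (tt j)^'+] -->
    v (date T tt j.+1) - (m (date T tt j.+1) - m (tt j)).
  by have -> : r j = v (date T tt j.+1) - (m (date T tt j.+1) - m (tt j))
    by exact/cvg_lim.
have tj : tt j < date T tt j.+1.
  by rewrite -(date_ord T) ltr_date// ltnSn /=.
have mj : m s @[s --> (tt j)^'+] --> m (tt j).
  by apply: (proj1 m_cadlag); rewrite (grid_ge0 _ grid)/= grid_lt_T.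
have : v (date T tt j.+1) - (m (date T tt j.+1) - m s) @[s --> (tt j)^'+] -->
    v (date T tt j.+1) - (m (date T tt j.+1) - m (tt j)).
  by apply: cvgB; [exact: cvg_cst|apply: cvgB => //; exact: cvg_cst].
apply: cvg_trans; apply: near_eq_cvg; near=> s.
apply/esym/backward_path_increment; apply/andP; split; near: s.
  exact: nbhs_right_gt.
exact: nbhs_right_le.
Unshelve. all: by end_near. Qed.

(** The jump at [t_j] is the single term that [t_j] contributes to the sum. *)
Lemma backward_path_date (j : 'I_N.+1) :
  v (tt j) = r j + phi (p (tt j) - r j).
Proof.
have [_ ->] := backward_path_right_limit j.
set q := phi _.
have [_ jT] := andP (date_itv grid (ltn_ord j)).
have jN : (j <= N)%N by rewrite -ltnS.
have jj : date T tt j < date T tt j.+1 <= date T tt j.+1.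
  by rewrite lexx andbT ltr_date// ltnSn.
have j0 : 0 <= tt j by exact: grid_ge0 grid.
have jT0 : 0 <= tt j <= T by rewrite j0 ltW// grid_lt_T.
rewrite (v_eq jT0) (v_eq (date_itv grid (ltn_ord j))).
rewrite (bigD1 j) /=; last by rewrite grid_from.
under eq_bigl => i do rewrite grid_from// -(inj_eq val_inj) eq_sym andbC
  -ltn_neqAle -(grid_after i grid jN jj).
have -> : phi (p (tt j) - r j) = q.
  by rewrite /q; have [_ ->] := backward_path_right_limit j.
set S := \sum_(i < _ | _) _; ring.
Qed.

End BackwardPath.

(** * Conditional expectations *)

Section ConditionalExpectation.
Context d (Omega : measurableType d) (R : realType) (Pr : probability Omega R).
Context (G : set_system Omega) (sG : sigma_algebra setT G)
  (mG : G `<=` measurable).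
Implicit Types (X Y Z : Omega -> R) (a b c : R).

(** A sigma-algebra generates itself, so the closure properties of measurable
    functions are available for [measurable_wrt]. *)
Lemma measurable_wrtP X :
  measurable_wrt G X <-> measurable_fun setT (X : g_sigma_algebraType G -> R).
Proof.
split=> [mX _ B mB|mX B mB].
  by rewrite setTI; apply: sub_sigma_algebra; exact: mX.
have := mX measurableT B mB; rewrite setTI.
by rewrite [X in X -> _](_ : _ = <<s G >> (X @^-1` B))// sigma_algebra_id.
Qed.

Lemma measurable_wrt_cst c : measurable_wrt G (fun=> c).
Proof. by apply/measurable_wrtP; exact: measurable_cst. Qed.

Lemma measurable_wrt_lin a b X Y : measurable_wrt G X -> measurable_wrt G Y ->
  measurable_wrt G (fun w => a * X w + b * Y w).
Proof.
move=> /measurable_wrtP mX /measurable_wrtP mY; apply/measurable_wrtP.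
by apply: measurable_funD; apply: measurable_funM => //; exact: measurable_cst.
Qed.

Lemma measurable_wrt_fun X : measurable_wrt G X -> measurable_fun setT X.
Proof. by move=> mX _ B mB; rewrite setTI; apply/mG/mX. Qed.

Lemma integrable_cst c : Pr.-integrable setT (EFin \o fun=> c).
Proof. exact: finite_measure_integrable_cst. Qed.

Lemma integrable_lin (A : set Omega) a b X Y : measurable A ->
  Pr.-integrable A (EFin \o X) -> Pr.-integrable A (EFin \o Y) ->
  Pr.-integrable A (EFin \o fun w => a * X w + b * Y w).
Proof.
move=> mA iX iY.
have -> : EFin \o (fun w => a * X w + b * Y w) =
    (fun w => a%:E * (X w)%:E)%E \+ (fun w => b%:E * (Y w)%:E)%E.
  by apply/funext => w /=; rewrite EFinD !EFinM.
by apply: integrableD => //; exact: integrableZl.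
Qed.

Lemma integral_lin (A : set Omega) a b X Y : measurable A ->
  Pr.-integrable A (EFin \o X) -> Pr.-integrable A (EFin \o Y) ->
  (\int[Pr]_(w in A) (a * X w + b * Y w)%:E =
   a%:E * \int[Pr]_(w in A) (X w)%:E + b%:E * \int[Pr]_(w in A) (Y w)%:E)%E.
Proof.
move=> mA iX iY.
under eq_integral do rewrite EFinD !EFinM.
by rewrite integralD ?integralZl //; exact: integrableZl.
Qed.

Lemma le_integrable_ae X Y : measurable_fun setT X ->
  Pr.-integrable setT (EFin \o Y) -> {ae Pr, forall w, `|X w| <= `|Y w|} ->
  Pr.-integrable setT (EFin \o X).
Proof.
move=> mX /integrableP[mY iY] XY; apply/integrableP.
have mEX : measurable_fun setT (EFin \o X) by exact: measurableT_comp.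
split => //; apply: le_lt_trans iY; apply: ae_ge0_le_integral => //.
- exact: measurableT_comp.
- exact: measurableT_comp.
- by apply: filterS XY => w /= + _; rewrite lee_fin.
Qed.

Lemma condexp_cst c : is_condexp Pr G (fun=> c) (fun=> c).
Proof.
by split; [exact: integrable_cst|exact: integrable_cst|
           exact: measurable_wrt_cst|].
Qed.

Lemma condexp_lin a b X Y X' Y' :
  is_condexp Pr G X Y -> is_condexp Pr G X' Y' ->
  is_condexp Pr G (fun w => a * X w + b * X' w) (fun w => a * Y w + b * Y' w).
Proof.
move=> [iX iY mY XY] [iX' iY' mY' XY'].
split; [exact: integrable_lin|exact: integrable_lin|exact: measurable_wrt_lin|].
move=> A GA; have mA := mG GA.
have iS Z : Pr.-integrable setT (EFin \o Z) -> Pr.-integrable A (EFin \o Z).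
  exact: integrableS.
by rewrite !integral_lin ?XY ?XY'//; exact: iS.
Qed.

(** On the event [Y < 0], which belongs to [G], the integral of [Y] equals that
    of [X] and is nonnegative; so [Y] vanishes almost everywhere there. *)
Lemma condexp_ge0 X Y : is_condexp Pr G X Y ->
  {ae Pr, forall w, 0 <= X w} -> {ae Pr, forall w, 0 <= Y w}.
Proof.
move=> [iX iY mY XY] X0; pose A := Y @^-1` `]-oo, 0[.
have GA : G A by exact: mY.
have mA := mG GA.
have iYA : Pr.-integrable A (EFin \o Y) by exact: integrableS iY.
have iXA : Pr.-integrable A (EFin \o X) by exact: integrableS iX.
have [mYA _] := integrableP _ _ _ iYA; have [mXA _] := integrableP _ _ _ iXA.
have IX : (0 <= \int[Pr]_(w in A) (X w)%:E)%E.
  rewrite (@ae_eq_integral _ _ _ Pr A (fun w => `|(X w)%:E|)%E)//.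
  - by apply: integral_ge0 => w _; rewrite abse_ge0.
  - exact: measurableT_comp.
  - by apply: filterS X0 => w Xw _ /=; rewrite ger0_norm.
have IY : (\int[Pr]_(w in A) `|(Y w)%:E| = 0)%E.
  apply/eqP; rewrite eq_le integral_ge0 ?andbT//.
  rewrite (eq_integral (fun w => - (Y w)%:E)%E).
    rewrite integralN ?XY//.
      by rewrite oppe_le0.
    exact: integrable_add_def.
  move=> w; rewrite inE /A/= in_itv/= => Yw.
  by rewrite ltr0_norm.
have [N [mN PN sN]] := (ae_eq_integral_abs Pr mA mYA).1 IY.
exists N; split => // w /= Yw; apply: sN => /= h; apply: Yw.
have [//|Yw] := leP 0 (Y w).
have /h[Yw0] : A w by rewrite /A/= in_itv.
by rewrite Yw0 ltxx in Yw.
Qed.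

(** A variable whose increments are those of a martingale inherits the
    martingale property; this is how the backward equation yields conditional
    expectations. *)
Lemma condexp_shift m n X Y : is_condexp Pr G m n ->
  Pr.-integrable setT (EFin \o X) -> measurable_wrt G Y ->
  {ae Pr, forall w, Y w = X w - (m w - n w)} -> is_condexp Pr G X Y.
Proof.
move=> [im ina mn mnE] iX mY YE.
have id0 : Pr.-integrable setT (EFin \o fun w => 1 * m w + -1 * n w).
  exact: integrable_lin.
pose Z w := 1 * X w + -1 * (1 * m w + -1 * n w).
have iZ : Pr.-integrable setT (EFin \o Z) by exact: integrable_lin.
have YZ : {ae Pr, forall w, Y w = Z w}.
  by apply: filterS YE => w ->; rewrite /Z; ring.
have iY : Pr.-integrable setT (EFin \o Y).
  apply: le_integrable_ae iZ _; first exact: measurable_wrt_fun.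
  by apply: filterS YZ => w ->.
split => // A GA; have mA := mG GA.
have iS U : Pr.-integrable setT (EFin \o U) -> Pr.-integrable A (EFin \o U).
  exact: integrableS.
transitivity (\int[Pr]_(w in A) (Z w)%:E)%E.
  apply: ae_eq_integral => //.
  - by have /integrableP[] := iS _ iY.
  - by have /integrableP[] := iS _ iZ.
  - by apply: filterS YZ => w -> _.
rewrite integral_lin//; [|exact: iS|exact: iS].
rewrite integral_lin//; [|exact: iS|exact: iS].
rewrite -mnE// !mul1e.
rewrite [X in (_ + _ * X)%E](_ : _ = 0)%E ?mule0 ?adde0//.
rewrite EFinN mulN1e subee//.
by apply: integrable_fin_num => //; exact: iS.
Qed.

End ConditionalExpectation.

(** * Comparison of two backward equations *)

Lemma date_ind (N : nat) (Q : nat -> Prop) : Q N.+1 ->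
  (forall j : 'I_N.+1, Q j.+1 -> Q j) -> forall k, (k <= N.+1)%N -> Q k.
Proof.
move=> QN step k kN; rewrite -(subKn kN).
elim: (N.+1 - k)%N (leq_subr k N.+1) => [|n ih] nN; first by rewrite subn0.
have jN : (N - n < N.+1)%N by rewrite ltnS leq_subr.
rewrite subSS; apply: (step (Ordinal jN)) => /=.
by rewrite -subSn//; apply: ih; exact: ltnW.
Qed.

Section BackwardProcess.
Context d (Omega : measurableType d) (R : realType) (Pr : probability Omega R).
Context (F : R -> set_system Omega) (hF : usual_filtration Pr F).
Context (T : R) (N : nat) (tt : 'I_N.+1 -> R) (grid : exercise_grid T tt).
Context (P : R -> Omega -> R).
Implicit Types (phi : R -> R) (X M : R -> Omega -> R).

Definition backward_process phi X M : Prop :=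
  [/\ adapted T F X, ui_martingale Pr T F M
    & {ae Pr, forall w, forall t, 0 <= t <= T ->
        X t w = P T w - (M T w - M t w)
          + \sum_(i < N.+1 | t <= tt i < T)
              phi (P (tt i) w - right_limit X (tt i) w)}].

Let date := date T tt.

Definition backward_relations phi X M w : Prop :=
  [/\ X T w = P T w,
      forall (j : 'I_N.+1) s, tt j < s <= date j.+1 ->
        X s w = X (date j.+1) w - (M (date j.+1) w - M s w),
      forall j : 'I_N.+1, X s w @[s --> (tt j)^'+] --> right_limit X (tt j) w,
      forall j : 'I_N.+1, right_limit X (tt j) w
        = X (date j.+1) w - (M (date j.+1) w - M (tt j) w)
    & forall j : 'I_N.+1, X (tt j) w =
        right_limit X (tt j) w + phi (P (tt j) w - right_limit X (tt j) w)].

Lemma backward_process_relations phi X M : backward_process phi X M ->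
  {ae Pr, forall w, backward_relations phi X M w}.
Proof.
move=> [_ [_ _ Mcadlag _] Xeq]; apply: filterS2 Mcadlag Xeq => w Mw Xw; split.
- exact: (backward_path_T grid (p := P ^~ w) Xw).
- exact: (backward_path_increment grid (p := P ^~ w) Xw).
- move=> j.
  by have [] := backward_path_right_limit grid (p := P ^~ w) Mw Xw j.
- move=> j.
  by have [] := backward_path_right_limit grid (p := P ^~ w) Mw Xw j.
- exact: (backward_path_date grid (p := P ^~ w) Mw Xw).
Qed.

Let sF t : 0 <= t -> sigma_algebra setT (F t).
Proof. by case: hF => h _ _ _ /h[]. Qed.

Let mF t : 0 <= t -> F t `<=` measurable.
Proof. by case: hF => h _ _ _ /h[]. Qed.

Lemma adapted_measurable X t : adapted T F X -> 0 <= t <= T ->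
  measurable_fun setT (X t).
Proof.
by move=> aX t0T; apply: measurable_wrt_fun (aX _ t0T); apply: mF; lra.
Qed.

Lemma martingale_integrable M t : ui_martingale Pr T F M -> 0 <= t <= T ->
  Pr.-integrable setT (EFin \o M t).
Proof. by move=> [_ h _ _] /andP[t0 tT]; have [] := h _ _ t0 tT (lexx T). Qed.

Let date_next (j : 'I_N.+1) : [/\ 0 <= tt j <= T, 0 <= date j.+1 <= T
  & tt j < date j.+1].
Proof.
split; first by rewrite (grid_ge0 _ grid) ltW// grid_lt_T.
  exact: date_itv.
by rewrite -(date_ord T tt) ltr_date// ltnSn /=.
Qed.

Lemma backward_process_condexp phi X M (j : 'I_N.+1) s :
  backward_process phi X M ->
  Pr.-integrable setT (EFin \o X (date j.+1)) ->
  tt j < s <= date j.+1 -> is_condexp Pr (F s) (X (date j.+1)) (X s).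
Proof.
move=> bX iX js; have [tj0 dj ltj] := date_next j.
have s0 : 0 <= s by lra.
have [aX [aM Mmart cM uM] _] := bX.
apply: (condexp_shift (mF s0) (m := M (date j.+1)) (n := M s)) => //.
- by apply: Mmart; lra.
- by apply: aX; lra.
- apply: filterS (backward_process_relations bX) => w [_ h _ _ _]; exact: h.
Qed.

Context (P_integrable : forall k, (k <= N.+1)%N ->
    Pr.-integrable setT (EFin \o P (date k))).

(** Going down the dates, [`|x + phi (p - x)|] is at most [`|p| + 2 * `|x|]. *)
Lemma backward_process_integrable phi X M : slopes_in01 phi -> phi 0 = 0 ->
  backward_process phi X M -> forall k, (k <= N.+1)%N ->
  Pr.-integrable setT (EFin \o X (date k)).
Proof.
move=> hphi phi0 bX; have rel := backward_process_relations bX.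
have [aX mM _] := bX.
apply: date_ind => [|j iX].
  apply: le_integrable_ae (P_integrable (leqnn _)) _.
    by apply: adapted_measurable => //; exact: date_itv.
  apply: filterS rel => w [+ _ _ _ _].
  by rewrite /date date_last => ->.
have [tj0 dj ltj] := date_next j.
pose r w := 1 * X (date j.+1) w + -1 * (1 * M (date j.+1) w + -1 * M (tt j) w).
have ir : Pr.-integrable setT (EFin \o r).
  by do 2!apply: integrable_lin => //; exact: martingale_integrable.
have iP : Pr.-integrable setT (EFin \o P (tt j)).
  by rewrite -(date_ord T tt); apply: P_integrable; exact: ltnW.
have iZ : Pr.-integrable setT
    (EFin \o (fun w => 1 * `|P (tt j) w| + 2 * `|r w|)).
  by apply: integrable_lin => //; exact: integrable_norm.
apply: le_integrable_ae iZ _; rewrite /date date_ord.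
  exact: adapted_measurable.
apply: filterS rel => w [_ _ _ rE ->].
have {rE} -> : right_limit X (tt j) w = r w by rewrite rE /r; ring.
have h1 := slopes_in01_le_norm (P (tt j) w - r w) hphi phi0.
have h2 := ler_normD (r w) (phi (P (tt j) w - r w)).
have h3 := ler_normB (P (tt j) w) (r w).
have h4 : 0 <= `|r w| by [].
apply: le_trans (ler_norm _); lra.
Qed.

Context (P_ge0 : forall t w, 0 <= t <= T -> 0 <= P t w).
Context (V M Vl Ml : R -> Omega -> R) (lambda : R) (lambda_gt0 : 0 < lambda).
Context (bV : backward_process (fun x => Num.max x 0) V M).
Context (bVl : backward_process (entropic_part lambda) Vl Ml).

Let iV k : (k <= N.+1)%N -> Pr.-integrable setT (EFin \o V (date k)).
Proof.
apply: (backward_process_integrable _ _ bV); first exact: slopes_in01_pos_part.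
exact: maxxx.
Qed.

Let iVl k : (k <= N.+1)%N -> Pr.-integrable setT (EFin \o Vl (date k)).
Proof.
apply: (backward_process_integrable _ _ bVl).
  exact: slopes_in01_entropic_part.
by rewrite /entropic_part mulr0 Phi0 mulr0.
Qed.

(** The bound is relative to [1 + x] rather than absolute: the conditional
    expectation of [1 + V] at the next date is [1 + V] again, whereas a bound by
    an arbitrary integrable variable would bring in its conditional
    expectations. *)
Definition close_to (e x y : R) : Prop := 0 <= x /\ `|x - y| <= e * (1 + x).

(** The bound says that [V] and [e * (1 + V) - (V - Vl)] and
    [e * (1 + V) + (V - Vl)] are nonnegative.  At every time in
    [(t_j, t_(j+1)]] these are conditional expectations of their values at
    [t_(j+1)], and the inequalities pass to the limit along a sequence of times
    that decreases to [t_j]. *)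
Lemma close_right_limit e (j : 'I_N.+1) :
  {ae Pr, forall w, close_to e (V (date j.+1) w) (Vl (date j.+1) w)} ->
  {ae Pr, forall w,
    close_to e (right_limit V (tt j) w) (right_limit Vl (tt j) w)}.
Proof.
move=> cl; have [tj0 dj ltj] := date_next j.
pose s n : R := tt j + (date j.+1 - tt j) * n.+1%:R^-1.
have s_itv n : tt j < s n <= date j.+1.
  have d0 : 0 < date j.+1 - tt j by rewrite subr_gt0.
  rewrite /s ltrDl mulr_gt0//=.
  by rewrite -lerBrDl ler_piMr ?(ltW d0)// invf_le1// ler1n.
have s_cvg : s n @[n --> \oo] --> tt j.
  rewrite -[X in _ --> X]addr0 -(mulr0 (date j.+1 - tt j)).
  apply: cvgD; first exact: cvg_cst.
  by apply: cvgM; [exact: cvg_cst|exact: cvg_harmonic].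
have cl_s : {ae Pr, forall w, forall n, [/\ 0 <= V (s n) w,
    0 <= e * (1 + V (s n) w) - (V (s n) w - Vl (s n) w)
  & 0 <= e * (1 + V (s n) w) + (V (s n) w - Vl (s n) w)]}.
  apply/ae_foralln => n; have s0 : 0 <= s n by have := s_itv n; lra.
  have cV := backward_process_condexp bV (iV (ltn_ord j)) (s_itv n).
  have cVl := backward_process_condexp bVl (iVl (ltn_ord j)) (s_itv n).
  have c1 := condexp_lin (sF s0) (mF s0) e e (condexp_cst Pr (sF s0) 1) cV.
  have c2 := condexp_lin (sF s0) (mF s0) 1 (-1) cV cVl.
  have cD := condexp_lin (sF s0) (mF s0) 1 1 c1 c2.
  have cB := condexp_lin (sF s0) (mF s0) 1 (-1) c1 c2.
  have V0 := condexp_ge0 (mF s0) cV; have D0 := condexp_ge0 (mF s0) cD.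
  have B0 := condexp_ge0 (mF s0) cB.
  apply: filterS3 (V0 _) (D0 _) (B0 _).
  - by move=> w h1 h2 h3; split; lra.
  - by apply: filterS cl => w [].
  - by apply: filterS cl => w [h0]; rewrite ler_norml; lra.
  - by apply: filterS cl => w [h0]; rewrite ler_norml; lra.
apply: filterS3 cl_s (backward_process_relations bV)
  (backward_process_relations bVl) => w cw [_ _ lV _ _] [_ _ lVl _ _].
have {lV} lV : V (s n) w @[n --> \oo] --> right_limit V (tt j) w.
  apply: (cvg_at_rightP _ _ _).1 (lV j) _ _; split => // n.
  by have /andP[] := s_itv n.
have {lVl} lVl : Vl (s n) w @[n --> \oo] --> right_limit Vl (tt j) w.
  apply: (cvg_at_rightP _ _ _).1 (lVl j) _ _; split => // n.
  by have /andP[] := s_itv n.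
have l1 : e * (1 + V (s n) w) @[n --> \oo] --> e * (1 + right_limit V (tt j) w).
  by apply: cvgM; [exact: cvg_cst|apply: cvgD => //; exact: cvg_cst].
have l2 : V (s n) w - Vl (s n) w @[n --> \oo] -->
    right_limit V (tt j) w - right_limit Vl (tt j) w by exact: cvgB.
split.
  by apply: (cvgr_to_ge lV); near=> n; have [] := cw n.
have : 0 <= e * (1 + right_limit V (tt j) w) -
    (right_limit V (tt j) w - right_limit Vl (tt j) w).
  by apply: (cvgr_to_ge (cvgB l1 l2)); near=> n; have [] := cw n.
have : 0 <= e * (1 + right_limit V (tt j) w) +
    (right_limit V (tt j) w - right_limit Vl (tt j) w).
  by apply: (cvgr_to_ge (cvgD l1 l2)); near=> n; have [] := cw n.
by rewrite ler_norml; lra.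
Unshelve. all: by end_near. Qed.

(** At each exercise date the constant grows by one unit of [sqrt lambda], the
    cost of exchanging the positive part and the entropic driver. *)
Lemma close_date k : (k <= N.+1)%N -> {ae Pr, forall w,
  close_to (Num.sqrt lambda * (N.+1 - k)%:R) (V (date k) w) (Vl (date k) w)}.
Proof.
have relV := backward_process_relations bV.
have relVl := backward_process_relations bVl.
move: k; apply: date_ind => [|j /close_right_limit cl].
  apply: filterS2 relV relVl => w [VT _ _ _ _] [VlT _ _ _ _].
  rewrite /date date_last /close_to VT VlT subrr normr0 subnn mulr0 mul0r.
  split=> //; apply: P_ge0.
  by have := date_itv grid (leqnn _); rewrite date_last.
apply: filterS3 relV relVl cl => w.
move=> [_ _ _ _ /(_ j) Vj] [_ _ _ _ /(_ j) Vlj] [r0 rl].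
rewrite /date date_ord.
set rV := right_limit V _ _ in Vj r0 rl.
set rVl := right_limit Vl _ _ in Vlj rl.
have [tj0 _ _] := date_next j.
have p0 := P_ge0 w tj0.
set p := P (tt j) w in Vj Vlj p0.
(* [V_(t_j)] is the maximum of the nonnegative [p] and [rV], hence it also
   dominates their distance. *)
have Vmax : [/\ p <= V (tt j) w, rV <= V (tt j) w & `|p - rV| <= V (tt j) w].
  rewrite Vj; case: (leP (p - rV) 0) => h.
    by rewrite ler0_norm//; split; lra.
  by rewrite gtr0_norm//; split; lra.
have [pV rV_V dV] := Vmax.
set m := Num.sqrt lambda in rl *; have m0 : 0 <= m by exact: sqrtr_ge0.
have e1 := entropic_part_approx (p - rV) lambda_gt0.
have e2 := slopes_in01_update p rV rVl (slopes_in01_entropic_part lambda_gt0).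
split; first lra.
have -> : (N.+1 - j)%:R = 1 + (N.+1 - j.+1)%:R :> R.
  by rewrite subSS nat1r -subSn// -ltnS.
set c := (N.+1 - j.+1)%:R in rl *.
have c0 : 0 <= c by exact: ler0n.
(* First the driver changes at the fixed value [rV], then [rV] becomes [rVl]
   with the entropic driver. *)
have -> : V (tt j) w - Vl (tt j) w =
    (Num.max (p - rV) 0 - entropic_part lambda (p - rV)) +
    ((rV + entropic_part lambda (p - rV)) -
     (rVl + entropic_part lambda (p - rVl))).
  by rewrite Vj Vlj; ring.
apply: le_trans (ler_normD _ _) _; apply: le_trans (lerD e1 e2) _.
rewrite -/m.
have h1 : m * (1 + `|p - rV|) <= m * (1 + V (tt j) w).
  by rewrite ler_wpM2l// lerD2l.
have h2 : m * c * (1 + rV) <= m * c * (1 + V (tt j) w).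
  by rewrite ler_wpM2l ?mulr_ge0// lerD2l.
have -> : m * (1 + c) * (1 + V (tt j) w) =
  m * (1 + V (tt j) w) + m * c * (1 + V (tt j) w) by ring.
lra.
Qed.

Lemma right_limit_approx : {ae Pr, forall w, forall j : 'I_N.+1,
  `|right_limit V (tt j) w - right_limit Vl (tt j) w|
    <= Num.sqrt lambda * N.+1%:R * (1 + `|right_limit V (tt j) w|)}.
Proof.
apply: filter_forall => j.
have := close_right_limit (close_date (ltn_ord j)).
apply: filterS => w [r0 h]; rewrite (ger0_norm r0); apply: le_trans h _.
rewrite ler_wpM2r ?addr_ge0// ler_wpM2l ?sqrtr_ge0// ler_nat.
exact: leq_subr.
Qed.

End BackwardProcess.

(** * Convergence of the exercise times *)

(** Since [V_(t_j)] is the maximum of [P] and [V_(t_j+)], which differ, it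
    equals [P] exactly when [V_(t_j+) < P].  Strict inequalities persist under small
    perturbations, so the sets of dates that define the two hitting times are
    eventually the same. *)
Lemma tau_hat_cvg_tau_star d (Omega : measurableType d) (R : realType) (T : R)
  (N : nat) (tt : 'I_N.+1 -> R) (grid : exercise_grid T tt)
  (P V : R -> Omega -> R) (I : Type) (L : set_system I) {FL : Filter L}
  (Y : I -> R -> Omega -> R)
  (w : Omega) (t : R) :
  V T w = P T w ->
  (forall j, V (tt j) w = right_limit V (tt j) w
                       + Num.max (P (tt j) w - right_limit V (tt j) w) 0) ->
  (forall j, right_limit V (tt j) w <> P (tt j) w) ->
  (forall j,
    right_limit (Y i) (tt j) w @[i --> L] --> right_limit V (tt j) w) ->
  tau_hat T tt P (Y i) t w @[i --> L] --> tau_star T tt P V t w.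
Proof.
move=> VT Vj Vneq Ycvg; apply: cvg_near_cst.
have near_le : \forall i \near L, forall j,
    (right_limit (Y i) (tt j) w <= P (tt j) w) =
    (right_limit V (tt j) w < P (tt j) w).
  apply: filter_forall => j.
  have [ltV|gtV|/Vneq//] := ltgtP (right_limit V (tt j) w) (P (tt j) w).
    by near=> i; apply/ltW; near: i; exact: (cvgr_lt _ (Ycvg j)).
  near=> i; apply/negbTE; rewrite -ltNge; near: i.
  exact: (cvgr_gt _ (Ycvg j)).
apply: filterS near_le => i le_i; rewrite /tau_hat /tau_star; congr inf.
apply/seteqP; split=> s /= [ds ts hs]; split => //.
  case: ds hs => [[j _ <-]|/= ->].
    rewrite /right_limit_conv lt_eqF ?grid_lt_T// le_i => ltV.
    by rewrite Vj max_l ?subr_ge0 ?ltW// subrKC.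
  by rewrite VT.
case: ds hs => [[j _ <-]|/= ->].
  rewrite /right_limit_conv lt_eqF ?grid_lt_T// le_i Vj => VP.
  rewrite lt_neqAle; apply/andP; split; first exact/eqP/Vneq.
  by rewrite -VP lerDl le_max lexx orbT.
by rewrite /right_limit_conv eqxx.
Unshelve. all: by end_near. Qed.

Lemma cvg_sqrt_bound (R : realType) (I : Type) (L : set_system I)
  {FL : Filter L} (l f : I -> R) (x c : R) :
  l i @[i --> L] --> (0 : R) ->
  (\forall i \near L, `|x - f i| <= Num.sqrt (l i) * c) -> f i @[i --> L] --> x.
Proof.
move=> l0 fb; apply/cvgrPdist_le => e e0.
have /cvgr0Pnorm_le/(_ e e0) lc : Num.sqrt (l i) * c @[i --> L] --> (0 : R).
  rewrite -(mul0r c) -(@sqrtr0 R); apply: cvgM; last exact: cvg_cst.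
  apply: continuous_cvg => //; exact: sqrt_continuous.
apply: filterS2 fb lc => i h1 h2.
exact: le_trans h1 (le_trans (ler_norm _) h2).
Qed.

Lemma exercise_date_integrable d (Omega : measurableType d) (R : realType)
  (Pr : probability Omega R) (F : R -> set_system Omega) (T : R) (N : nat)
  (tt : 'I_N.+1 -> R) (P : R -> Omega -> R) :
  usual_filtration Pr F -> exercise_grid T tt -> adapted T F P ->
  (forall t w, 0 <= t <= T -> 0 <= P t w) ->
  (forall u, exercise_dates T tt u -> ('E_Pr[P u] < +oo)%E) ->
  forall k, (k <= N.+1)%N -> Pr.-integrable setT (EFin \o P (date T tt k)).
Proof.
move=> hF grid aP P0 EP k kN; have u0T := date_itv grid kN.
apply/integrableP; split.
  by apply/measurable_EFinP; exact: (adapted_measurable hF aP u0T).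
have : exercise_dates T tt (date T tt k).
  move: kN; rewrite leq_eqVlt => /predU1P[->|kN].
    by right; rewrite date_last.
  by left; exists (Ordinal kN) => //; rewrite -(date_ord T tt).
move=> /EP; rewrite unlock; apply: le_lt_trans.
by rewrite le_eqVlt; apply/orP; left; apply/eqP/eq_integral => w _ /=;
  rewrite ger0_norm// P0.
Qed.

(* The processes V^lambda are unique only up to indistinguishability, so that
   for the uncountable family (V^lambda)_{lambda > 0} almost sure convergence
   as lambda decreases to 0 is stated in the two meaningful ways: along every
   sequence whatever the versions, and along the full filter at 0+ for
   suitable versions (the same for all t). *)
Theorem proposition3p2
  (d : measure_display) (Omega : measurableType d) (R : realType)
  (Pr : probability Omega R)
  (F : R -> set_system Omega) (hF : usual_filtration Pr F)
  (T : R) (hT : 0 < T)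
  (N : nat) (tt : 'I_N.+1 -> R) (htt : exercise_grid T tt)
  (P : R -> Omega -> R)
  (P_ge0 : forall t w, 0 <= t <= T -> 0 <= P t w)
  (P_adapted : adapted T F P)
  (P_int : forall u, exercise_dates T tt u -> ('E_Pr[P u] < +oo)%E)
  (V : R -> Omega -> R) (hV : value_process Pr F T tt P V)
  (Vl Ml : R -> R -> Omega -> R)
  (hVl : forall lambda : R, 0 < lambda ->
     entropy_solution Pr F T tt P lambda (Vl lambda) (Ml lambda))
  (hnull : Pr.-negligible
     (\bigcup_(j in [set: 'I_N.+1])
        [set w | right_limit V (tt j) w = P (tt j) w])) :
  (forall (t : R), 0 <= t <= T ->
     forall l : nat -> R, (forall n, 0 < l n) -> l n @[n --> \oo] --> 0 ->
     {ae Pr, forall w,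
        tau_hat T tt P (Vl (l n)) t w @[n --> \oo] --> tau_star T tt P V t w})
  /\
  (exists2 W : R -> R -> Omega -> R,
     forall lambda : R, 0 < lambda ->
       indistinguishable Pr T (W lambda) (Vl lambda) &
     forall t : R, 0 <= t <= T ->
     {ae Pr, forall w,
        tau_hat T tt P (W lambda) t w @[lambda --> 0^'+]
          --> tau_star T tt P V t w}).
Proof.
have iP := exercise_date_integrable hF htt P_adapted P_ge0 P_int.
have [M bV] : exists M,
    backward_process Pr F T tt P (fun x => Num.max x 0) V M.
  by case: hV => aV _ [M mM Veq]; exists M.
have bVl lambda : 0 < lambda -> backward_process Pr F T tt P
    (entropic_part lambda) (Vl lambda) (Ml lambda).
  by move=> /hVl[aX _ mM _ Xeq].
pose good lambda w := forall j : 'I_N.+1,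
  `|right_limit V (tt j) w - right_limit (Vl lambda) (tt j) w|
    <= Num.sqrt lambda * (N.+1%:R * (1 + `|right_limit V (tt j) w|)).
have ae_good lambda : 0 < lambda -> {ae Pr, forall w, good lambda w}.
  move=> l0.
  have := right_limit_approx hF htt iP P_ge0 l0 bV (bVl _ l0).
  by apply: filterS => w h j; rewrite mulrA; exact: h.
have ae_V : {ae Pr, forall w, [/\ V T w = P T w,
    forall j, V (tt j) w = right_limit V (tt j) w
                         + Num.max (P (tt j) w - right_limit V (tt j) w) 0
  & forall j, right_limit V (tt j) w <> P (tt j) w]}.
  have ae_neq : {ae Pr, forall w j, right_limit V (tt j) w <> P (tt j) w}.
    apply: negligibleS hnull => w /= /existsNP[j /contrapT Vj].
    by exists j.
  apply: filterS2 (backward_process_relations htt bV) ae_neq => w.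
  by move=> [VT _ _ _ Vj] Vneq.
split.
- move=> t _ l l_gt0 l0.
  have ae_l : {ae Pr, forall w, forall n, good (l n) w}.
    by apply/ae_foralln => n; exact: ae_good.
  apply: filterS2 ae_V ae_l => w [VT Vj Vneq] good_l.
  apply: tau_hat_cvg_tau_star => // j.
  apply: (cvg_sqrt_bound (c := N.+1%:R * (1 + `|right_limit V (tt j) w|)) l0).
  by apply: nearW => n; exact: good_l.
- (* Uncountably many null sets cannot be removed at once; instead the path is
     corrected, for each [lambda], on the null set where the bound fails. *)
  exists (fun lambda s w =>
    if `[< good lambda w >] then Vl lambda s w else V s w).
    move=> lambda l0; apply: filterS (ae_good _ l0) => w gw t _.
    by rewrite asboolT.
  move=> t _; apply: filterS ae_V => w [VT Vj Vneq].
  apply: tau_hat_cvg_tau_star => // j.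
  apply: (@cvg_sqrt_bound _ _ _ _ id _ _
    (N.+1%:R * (1 + `|right_limit V (tt j) w|))).
    exact/cvg_at_right_filter/cvg_id.
  apply: nearW => lambda; rewrite /right_limit.
  have [gw|bw] := pselect (good lambda w).
    by rewrite asboolT//; exact: gw.
  by rewrite asboolF// subrr normr0 mulr_ge0 ?sqrtr_ge0.
Qed.
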